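(* Let $k\ge 1$ and $p\ge 1$ be integers. A $k$-step LIMM-W method $$\sum_{i=-1}^{k-1} \alpha_i\, y_{n-i} = h_n \sum_{i=0}^{k-1} \beta_i\, f(y_{n-i}) + h_n\, \mathbf{A}_n \left( \sum_{i=-1}^{k-1} \mu_i\, y_{n-i} + h_n \sum_{i=0}^{k-1} \nu_i\, f(y_{n-i}) \right),\qquad \alpha_{-1}=1,$$ with $\mathbf{A}_n$ an arbitrary matrix, applied on a (generally non-uniform) grid $t_{n-i}=t_n-c_i h_n$, has order of consistency $p$ if and only if its coefficients satisfy $$\sum_{i=-1}^{k-1} \alpha_i = 0,\qquad \sum_{i=-1}^{k-1} \mu_i = 0,$$ $$\sum_{i=-1}^{k-1} \alpha_i\, c_i^{\ell} + \ell \sum_{i=0}^{k-1} \beta_i\, c_i^{\ell-1} = 0, \qquad \ell = 1,\dots,p,$$ $$\sum_{i=-1}^{k-1} \mu_i\, c_i^{\ell-1} - (\ell-1) \sum_{i=0}^{k-1} \nu_i\, c_i^{\ell-2} = 0, \qquad \ell = 2,\dots,p.$$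
   Context: The method integrates the initial value problem $y'=f(y)$, $y(t_0)=y_0$, $t_0\le t\le t_F$, with $y(t)\in\mathbb{R}^N$ and $f:\mathbb{R}^N\to\mathbb{R}^N$ sufficiently smooth (autonomous form; a non-autonomous problem is reduced to it by appending $t$ to $y$). Here $y_{n-i}\approx y(t_{n-i})$ and $h_n=t_{n+1}-t_n$. The real coefficients $\alpha_i,\mu_i$ ($i=-1,\dots,k-1$) and $\beta_i,\nu_i$ ($i=0,\dots,k-1$) may depend on the grid fractions $c_j$. The step fractions $c_i$ are defined by $t_{n-i}=t_n-c_i h_n$, so $c_{-1}=-1$, $c_0=0$. The convention $0^0=1$ is used. LIMM-W: the matrix $\mathbf{A}_n\in\mathbb{R}^{N\times N}$ is arbitrary (it need not approximate the Jacobian $f_y(y_n)$), and the order of accuracy is required not to depend on its choice; thus order of consistency is understood for all smooth problems and all choices of $\mathbf{A}_n$. Order of consistency $p$: when the method is started from exact past values $y_{n-i}=y(t_{n-i})$, $i=0,\dots,k-1$ (with $y(\cdot)$ an exact solution of $y'=f(y)$), the resulting $y_{n+1}$ satisfies $y_{n+1}-y(t_{n+1})=\mathcal{O}(h_n^{p+1})$ as $h_n\to 0$ with the $c_i$ fixed. *)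

(* Defs.v *)
From HB Require Import structures.
From mathcomp Require Import all_boot all_order all_algebra.
From mathcomp Require Import all_classical all_reals all_analysis.

Set Implicit Arguments.
Unset Strict Implicit.
Unset Printing Implicit Defensive.

Import Order.TTheory GRing.Theory Num.Theory.
Import numFieldNormedType.Exports.

Local Open Scope classical_set_scope.
Local Open Scope ring_scope.

(* Sums over i = -1, ..., k-1 are written \sum_(j < k.+1) F (j%:Z - 1), so
   that the coefficients keep their integer indices; only the values at
   -1, ..., k-1 of functions indexed by int are ever used. *)

(* The usual class C^r; since V is meant to be finite dimensional, it is
   enough to control the directional derivatives in each fixed direction. *)
Fixpoint Cr (R : realType) (V W : normedModType R) (r : nat) (g : V -> W) :
    Prop :=
  if r is r'.+1 then
    (forall x : V, differentiable g x) /\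
    (forall v : V, Cr r' (fun x => 'D_v g x))
  else continuous g.

(* At the end points the equation holds for one-sided derivatives, by
   continuity of f and y. *)
Definition ode_solution (R : realType) (N : nat) (f : 'cV[R]_N -> 'cV[R]_N)
    (t0 tF : R) (y : R -> 'cV[R]_N) : Prop :=
  {within `[t0, tF], continuous y} /\
  (forall t : R, t \in `]t0, tF[ -> is_derive t (1 : R) y (f (y t))).

(* Y i stands for y_{n-i}; the equation is implicit in Y (-1) = y_{n+1}. *)
Definition limm_step (R : realType) (N k : nat)
    (alpha mu : int -> R) (beta nu : nat -> R)
    (f : 'cV[R]_N -> 'cV[R]_N) (A : 'M[R]_N) (h : R)
    (Y : int -> 'cV[R]_N) : Prop :=
  \sum_(j < k.+1) alpha (j%:Z - 1) *: Y (j%:Z - 1) =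
    h *: (\sum_(i < k) beta i *: f (Y i%:Z)) +
    h *: (A *m (\sum_(j < k.+1) mu (j%:Z - 1) *: Y (j%:Z - 1) +
                h *: (\sum_(i < k) nu i *: f (Y i%:Z)))).

(* Consistency of order (at least) p, for right-hand sides of class C^r and
   every matrix A. Here z h is the numerical value y_{n+1} computed with step
   size h from exact past values. For small h > 0 it is uniquely determined,
   the matrix alpha (-1) I - h mu (-1) A being invertible if
   alpha (-1) <> 0. *)
Definition limmw_consistent (R : realType) (N k : nat) (c : int -> R)
    (alpha mu : int -> R) (beta nu : nat -> R) (r p : nat) : Prop :=
  forall (f : 'cV[R]_N -> 'cV[R]_N) (A : 'M[R]_N) (t0 tF tn : R)
    (y z : R -> 'cV[R]_N),
  Cr r f ->
  ode_solution f t0 tF y ->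
  (\forall h \near 0^'+, forall j : 'I_k.+1,
     tn - c (j%:Z - 1) * h \in `[t0, tF]) ->
  (\forall h \near 0^'+,
     limm_step k alpha mu beta nu f A h
       (fun i => if i == -1 then z h else y (tn - c i * h))) ->
  (fun h => z h - y (tn + h)) =O_ (0^'+) (fun h => h ^+ p.+1).

(* Main.v *)
Require Import Defs.
From HB Require Import structures.
From mathcomp Require Import all_boot all_order all_algebra.
From mathcomp Require Import all_classical all_reals all_analysis.
From mathcomp Require Import ring lra.

Import Order.TTheory GRing.Theory Num.Theory.
Import numFieldNormedType.Exports.

Local Open Scope classical_set_scope.
Local Open Scope ring_scope.

(** Let y be an exact solution, E = z h - y (tn + h) the error of one step, and
    D the residual left when the exact values y (tn - c i * h) are put into the
    scheme, including i = -1.  The scheme is affine in y_(n+1), so the equation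
    that defines z h reads
      E - h mu_(-1) A E = - D,
    and for small h the matrix on the left is close to the identity: E and D
    have the same order in h.

    Coordinate i of D splits as D_i = P_i - h * \sum_j A i j * Q_j, where P_i
    and Q_j are defects of two classical linear multistep formulas,
    (alpha, beta) and (mu, - nu), along coordinates of y.  Taylor expansion at tn
    shows that the defect of a formula (a, b) along u is
      \sum_l (- h) ^ l / l! * u^(l)(tn) * C_l(a, b) + higher order,
      C_l(a, b) = \sum_j a_j c_j ^ l + l * \sum_i b_i c_i ^ (l - 1),
    and the conditions of the theorem say exactly that C_l(alpha, beta) = 0 for
    l <= p and C_l(mu, - nu) = 0 for l < p ([order_conditionsP]); the factor h
    in front of the second defect accounts for the loss of one index.

    Sufficiency: D = O(h ^ (p + 1)), hence E too.  The only analytic input is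
    that y has p + 1 derivatives, continuous up to the end points of the
    interval, when f is of class C^p.  They are found explicitly: the derivative
    of g (y t) is (L g) (y t), where L g = 'D_f g is the Lie derivative along f,
    and L sends C^(m+1) to C^m when f is C^m ([ode_solution_jet]).

    Necessity: the linear problem y' = y, y = exp t, with A = a I, already
    detects everything, because all derivatives of exp are 1 at 0.  The choice
    a = 0 isolates the first defect, a = 1 then gives the second, and a
    polynomial of degree at most m which is O(h ^ (m + 1)) vanishes
    ([Oh_polynomial]). *)

(** * Taylor expansion on a closed interval *)

(** The U l are the successive derivatives of U 0.  The equations are asked in
    the open interval and continuity up to the end points, because a step may
    start at an end point, where only one-sided derivatives make sense. *)
Definition jet {R : realType} (a b : R) (m : nat) (U : nat -> R -> R) : Prop :=
  (forall l, (l <= m)%N -> {within `[a, b], continuous (U l)}) /\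
  (forall l t, (l < m)%N -> t \in `]a, b[ -> is_derive t 1 (U l) (U l.+1 t)).

(** The points s and t come in either order because grid points lie on both sides
    of the expansion point. *)
Lemma mean_value_between {R : realType} {a b : R} {F dF : R -> R} :
  {within `[a, b], continuous F} ->
  (forall t, t \in `]a, b[ -> is_derive t 1 F (dF t)) ->
  forall s t, s \in `[a, b] -> t \in `[a, b] ->
  exists x, [/\ x \in `[a, b], `|x - s| <= `|t - s| &
    F t - F s = dF x * (t - s)].
Proof.
move=> cF dF_.
have mvt s t : s \in `[a, b] -> t \in `[a, b] -> s <= t ->
    exists2 x, x \in `[s, t] & F t - F s = dF x * (t - s).
  rewrite !in_itv /= => /andP[as_ _] /andP[_ tb] st.
  have dF' u : u \in `]s, t[ -> is_derive u 1 F (dF u).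
    rewrite in_itv /= => /andP[su ut]; apply: dF_.
    by rewrite in_itv /= (le_lt_trans as_ su) (lt_le_trans ut tb).
  have cF' : {within `[s, t], continuous F}.
    apply: continuous_subspaceW cF.
    by apply: subset_itv; rewrite bnd_simp.
  exact: (MVT_segment st dF' cF').
have sub s t x : s \in `[a, b] -> t \in `[a, b] -> x \in `[s, t] -> x \in `[a, b].
  rewrite !in_itv /= => /andP[as_ _] /andP[_ tb] /andP[sx xt].
  by rewrite (le_trans as_ sx) (le_trans xt tb).
move=> s t sab tab; have [st|/ltW ts] := leP s t.
  have [x xst E] := mvt s t sab tab st.
  exists x; split=> //; first exact: sub xst.
  move: xst; rewrite in_itv /= => /andP[sx xt].
  by rewrite !ger0_norm ?subr_ge0// lerD2r.
have [x xst E] := mvt t s tab sab ts.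
exists x; split.
- exact: sub xst.
- move: xst; rewrite in_itv /= => /andP[tx xs].
  by rewrite !ler0_norm ?subr_le0// lerN2 lerD2r.
- by rewrite -opprB E -mulrN opprB.
Qed.

(** By induction on m: the derivative of the remainder of U 0 is the remainder of
    U 1, which is at most M * |x - s| ^ m, and the mean value theorem turns this
    into M * |t - s| ^ m.+1.  Hence a bound of the last function U m serves as
    the constant at every stage. *)
Lemma taylor_bound {R : realType} {a b : R} {m : nat} {U : nat -> R -> R} :
  a <= b -> jet a b m U ->
  exists2 M : R, 0 <= M & forall s t, s \in `[a, b] -> t \in `[a, b] ->
    `|U 0%N t - \sum_(l < m) l`!%:R^-1 * U l s * (t - s) ^+ l|
      <= M * `|t - s| ^+ m.
Proof.
move=> ab; elim: m U => [|m IH] U [cU dU].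
  have [x _ xmax] := EVT_max ab (cU 0%N isT).
  have [y _ ymin] := EVT_min ab (cU 0%N isT).
  exists (`|U 0%N x| + `|U 0%N y|) => [|s t _ tab]; first exact: addr_ge0.
  rewrite big_ord0 subr0 expr0 mulr1 ler_norml.
  have := xmax t tab; have := ymin t tab.
  have := ler_norm (U 0%N x); have := ler_norm (- U 0%N y).
  have := normr_ge0 (U 0%N x); have := normr_ge0 (U 0%N y).
  by rewrite normrN; lra.
have [|M M0 HM] := IH (fun l => U l.+1).
  by split=> [l lm|l t lm]; [exact: cU|exact: dU].
exists M => // s t sab tab.
pose P (u : R) := \sum_(l < m.+1) l`!%:R^-1 * U l s * (u - s) ^+ l.
pose dP (u : R) := \sum_(l < m) l`!%:R^-1 * U l.+1 s * (u - s) ^+ l.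
have dPE (u : R) : is_derive u 1 P (dP u).
  have -> : P = \sum_(l < m.+1)
      (fun v : R => l`!%:R^-1 * U l s * (v - s) ^+ l).
    by apply/funext => v; rewrite /P fct_sumE.
  rewrite /dP.
  have dX (l : nat) : is_derive u 1 (fun v : R => l`!%:R^-1 * U l s * (v - s) ^+ l)
    (l`!%:R^-1 * U l s * (l%:R * (u - s) ^+ l.-1)).
    have dXs : is_derive u 1 (fun v : R => v - s) 1.
      by apply: is_derive_eq; rewrite subr0.
    have dXl : is_derive u 1 (fun v : R => (v - s) ^+ l) (l%:R * (u - s) ^+ l.-1).
      have := @is_deriveX _ _ (fun v : R => v - s) l u 1 1 dXs.
      rewrite /GRing.scale/= mulr1; congr (is_derive _ _ _ _).
      by apply/funext => v; rewrite exprfctE.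
    exact: (@is_deriveZ _ _ _ (fun v : R => (v - s) ^+ l) (l`!%:R^-1 * U l s)).
  apply: (is_derive_eq (is_derive_sum (fun l : 'I_m.+1 => dX l))).
  rewrite big_ord_recl /= mul0r mulr0 add0r; apply: eq_bigr => l _.
  rewrite /bump /= add1n factS natrM invfM; field.
  by rewrite nat1r !pnatr_eq0 -lt0n fact_gt0.
have cP : {within `[a, b], continuous P}.
  apply: continuous_subspaceT => u.
  by apply/differentiable_continuous/derivable1_diffP; case: (dPE u).
have [||x [xab xs E]] := @mean_value_between R a b (U 0%N \- P)
   (fun u => U 1%N u - dP u) _ _ s t sab tab.
- by move=> u; apply: cvgB; [exact: cU|exact: cP].
- move=> u uab; apply: is_deriveB; exact: dU.
have PS : P s = U 0%N s.
  rewrite /P big_ord_recl /= subrr expr0 fact0 invr1 mul1r mulr1 big1 ?addr0//.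
  by move=> i _; rewrite expr0n mulr0.
have -> : U 0%N t - P t = (U 1%N x - dP x) * (t - s).
  by rewrite -E /= PS subrr subr0.
rewrite normrM exprSr mulrA ler_wpM2r//.
apply: le_trans (HM s x sab xab) _.
by rewrite ler_wpM2l// lerXn2r// nnegrE.
Qed.

(** * Orders of magnitude as h tends to 0 from the right *)

(** The relation F = O(h ^ m) at 0 from the right; as h is positive there, the
    bound needs no absolute value around h ^ m. *)
Definition Oh {R : realType} (m : nat) (F : R -> R) : Prop :=
  exists M : R, \forall h \near 0^'+, `|F h| <= M * h ^+ m.

Lemma Oh_near {R : realType} {m : nat} {F G : R -> R} :
  (\forall h \near 0^'+, F h = G h) -> Oh m F -> Oh m G.
Proof.
move=> FG [M HM]; exists M; near=> h.
have <- : F h = G h by near: h.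
by near: h.
Unshelve. all: by end_near. Qed.

Lemma OhD {R : realType} {m : nat} {F G : R -> R} :
  Oh m F -> Oh m G -> Oh m (fun h => F h + G h).
Proof.
move=> [M HM] [K HK]; exists (M + K); near=> h.
rewrite mulrDl (le_trans (ler_normD _ _))// lerD//; by near: h.
Unshelve. all: by end_near. Qed.

Lemma OhZ {R : realType} {m : nat} (q : R) {F : R -> R} :
  Oh m F -> Oh m (fun h => q * F h).
Proof.
move=> [M HM]; exists (`|q| * M); near=> h.
rewrite normrM -mulrA ler_wpM2l//; by near: h.
Unshelve. all: by end_near. Qed.

Lemma Oh_sum {R : realType} {m n : nat} {F : 'I_n -> R -> R} :
  (forall i, Oh m (F i)) -> Oh m (fun h => \sum_(i < n) F i h).
Proof.
elim: n F => [|n IH] F HF.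
  by exists 0; near=> h; rewrite big_ord0 normr0 mul0r.
apply: (@Oh_near _ _ (fun h => F ord0 h + \sum_(i < n) F (lift ord0 i) h)).
  by near=> h; rewrite big_ord_recl.
by apply: OhD => //; apply: IH => i.
Unshelve. all: by end_near. Qed.

Lemma Oh_mulX {R : realType} {m : nat} {F : R -> R} :
  Oh m.+1 (fun h => h * F h) <-> Oh m F.
Proof.
split=> -[M HM]; exists M; near=> h.
  have h0 : 0 < h by near: h; exact: nbhs_right_gt.
  rewrite -(ler_pM2l h0) mulrCA -exprS -{1}(gtr0_norm h0) -normrM.
  by near: h.
have h0 : 0 < h by near: h; exact: nbhs_right_gt.
rewrite normrM gtr0_norm// exprS mulrCA ler_pM2l//.
by near: h.
Unshelve. all: by end_near. Qed.

Lemma Oh_le {R : realType} {m n : nat} {F : R -> R} :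
  (m <= n)%N -> Oh n F -> Oh m F.
Proof.
move=> mn [M HM]; exists `|M|; near=> h.
have h0 : 0 < h by near: h; exact: nbhs_right_gt.
have h1 : h < 1 by near: h; exact: nbhs_right_lt.
apply: (@le_trans _ _ (M * h ^+ n)); first by near: h.
rewrite (le_trans (ler_wpM2r _ (ler_norm _))) ?exprn_ge0 ?(ltW h0)//.
by rewrite ler_wpM2l// ler_wiXn2l// ltW.
Unshelve. all: by end_near. Qed.

Lemma Oh1_cst {R : realType} (q : R) : Oh 1 (fun=> q) -> q = 0.
Proof.
move=> [M HM]; apply/eqP; rewrite -normr_eq0; apply: contraT => q0.
have qgt : 0 < `|q| by rewrite lt_neqAle eq_sym q0 normr_ge0.
have M1 : 0 < `|M| + 1 by rewrite ltr_wpDl.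
have [h [qM h0 hq]] : exists h : R,
    [/\ `|q| <= M * h ^+ 1, 0 < h & h < `|q| / (`|M| + 1)].
  apply: (@filter_ex _ (0^'+)); near=> h; split; near: h.
  - exact: HM.
  - exact: nbhs_right_gt.
  - by apply: nbhs_right_lt; rewrite divr_gt0.
move: hq; rewrite ltr_pdivlMr// => hq.
have := ler_norm M; rewrite expr1 in qM; nra.
Unshelve. all: by end_near. Qed.

(** The constant coefficient is O(h), hence zero; dividing by h leaves a
    polynomial of smaller degree of the same kind. *)
Lemma Oh_polynomial {R : realType} (m : nat) (q : nat -> R) :
  Oh m (fun h => \sum_(l < m) q l * h ^+ l) ->
  forall l, (l < m)%N -> q l = 0.
Proof.
elim: m q => [//|m IH] q Oq.
have split_sum h : \sum_(l < m.+1) q l * h ^+ l =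
    q 0%N + h * (\sum_(l < m) q l.+1 * h ^+ l).
  rewrite big_ord_recl /= mulr1 mulr_sumr; congr (_ + _).
  by apply: eq_bigr => l _; rewrite mulrCA -exprS.
have bounded : Oh 0 (fun h => \sum_(l < m) q l.+1 * h ^+ l).
  apply: Oh_sum => l; apply: OhZ; apply: (@Oh_le _ _ l) => //.
  by exists 1; near=> h; rewrite mul1r ger0_norm// exprn_ge0.
have q0 : q 0%N = 0.
  apply: Oh1_cst.
  have Oq1 := Oh_le (isT : (1 <= m.+1)%N) Oq.
  have := OhD Oq1 (OhZ (-1) (proj2 Oh_mulX bounded)).
  apply: Oh_near; near=> h; rewrite split_sum; ring.
case=> [//|l] lm; apply: (IH (fun l => q l.+1)) => //.
apply/Oh_mulX; apply: Oh_near Oq; near=> h.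
by rewrite split_sum q0 add0r.
Unshelve. all: by end_near. Qed.

(** * Defect of a linear multistep formula *)

(** What is left when a function u with derivative v is put into the formula
    with coefficients a and b. *)
Definition lmm_defect {R : realType} (k : nat) (c a : int -> R) (b : nat -> R)
    (u v : R -> R) (t h : R) : R :=
  \sum_(j < k.+1) a (j%:Z - 1) * u (t - c (j%:Z - 1) * h) -
  h * (\sum_(i < k) b i * v (t - c i%:Z * h)).

(** Up to the factor (-1) ^ l / l!, the coefficient of u^(l)(t) h ^ l in the
    Taylor expansion of the defect. *)
Definition lmm_coef {R : realType} (k : nat) (c a : int -> R) (b : nat -> R)
    (l : nat) : R :=
  \sum_(j < k.+1) a (j%:Z - 1) * c (j%:Z - 1) ^+ l +
  l%:R * (\sum_(i < k) b i * c i%:Z ^+ (l - 1)).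

Lemma taylor_Oh {R : realType} {a b t c : R} {m : nat} {U : nat -> R -> R} :
  jet a b m U -> t \in `[a, b] ->
  (\forall h \near 0^'+, t - c * h \in `[a, b]) ->
  Oh m (fun h => U 0%N (t - c * h) -
                 \sum_(l < m) l`!%:R^-1 * U l t * (- (c * h)) ^+ l).
Proof.
move=> jU tab near_ab.
have ab : a <= b by move: tab; rewrite in_itv /= => /andP[]; exact: le_trans.
have [M _ HM] := taylor_bound ab jU.
exists (M * `|c| ^+ m); near=> h.
have h0 : 0 < h by near: h; exact: nbhs_right_gt.
have := HM t (t - c * h) tab; rewrite (_ : t - c * h - t = - (c * h)); last ring.
rewrite normrN normrM (gtr0_norm h0) exprMn mulrA; apply.
by near: h.
Unshelve. all: by end_near. Qed.

Lemma succ_sub1 (i : nat) : i.+1%:Z - 1 = i%:Z.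
Proof. by rewrite -addn1 PoszD addrK. Qed.

(** Expanding u = U 0 to order m.+1 and v = U 1 to order m is enough, since v comes
    with a factor h.  The expansions of u and v are then collected by powers of
    h, the l-th term of v contributing to h ^ l.+1. *)
Lemma lmm_defect_expansion {R : realType} {k : nat} (c a : int -> R)
    (b : nat -> R) {t0 tF t : R} {m : nat} {U : nat -> R -> R} :
  jet t0 tF m.+1 U -> t \in `[t0, tF] ->
  (\forall h \near 0^'+, forall j : 'I_k.+1, t - c (j%:Z - 1) * h \in `[t0, tF]) ->
  Oh m.+1 (fun h => lmm_defect k c a b (U 0%N) (U 1%N) t h -
    \sum_(l < m.+1) l`!%:R^-1 * U l t * (-1) ^+ l * lmm_coef k c a b l * h ^+ l).
Proof.
move=> jU tab near_ab.
have near_j (j : 'I_k.+1) : \forall h \near 0^'+, t - c (j%:Z - 1) * h \in `[t0, tF].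
  by near=> h; move: j; near: h.
have jU' : jet t0 tF m (fun l => U l.+1).
  by case: jU => cU dU; split=> [l lm|l x lm]; [exact: cU|exact: dU].
pose rest (j : 'I_k.+1) h := U 0%N (t - c (j%:Z - 1) * h) -
  \sum_(l < m.+1) l`!%:R^-1 * U l t * (- (c (j%:Z - 1) * h)) ^+ l.
pose rest' (i : 'I_k) h := U 1%N (t - c i%:Z * h) -
  \sum_(l < m) l`!%:R^-1 * U l.+1 t * (- (c i%:Z * h)) ^+ l.
have Orest j : Oh m.+1 (rest j) by exact: (taylor_Oh jU tab (near_j j)).
have Orest' i : Oh m (rest' i).
  apply: (taylor_Oh jU' tab).
  have := near_j (lift ord0 i); rewrite lift0 succ_sub1; exact.
have := OhD (Oh_sum (fun j => OhZ (a (j%:Z - 1)) (Orest j)))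
  (OhZ (-1) (proj2 Oh_mulX (Oh_sum (fun i => OhZ (b i) (Orest' i))))).
apply: Oh_near; near=> h.
rewrite /rest /rest' /lmm_defect /lmm_coef.
under eq_bigr do rewrite mulrBr.
rewrite sumrB.
under [X in _ + _ * (_ * X)]eq_bigr do rewrite mulrBr.
rewrite sumrB mulrBr mulN1r opprB.
set u := \sum_(j < k.+1) _ * U 0%N _; set v := h * \sum_(i < k) _ * U 1%N _.
suff -> : \sum_(l < m.+1) l`!%:R^-1 * U l t * (-1) ^+ l *
    (\sum_(j < k.+1) a (j%:Z - 1) * c (j%:Z - 1) ^+ l +
     l%:R * (\sum_(i < k) b i * c i%:Z ^+ (l - 1))) * h ^+ l =
  \sum_(j < k.+1) a (j%:Z - 1) *
     (\sum_(l < m.+1) l`!%:R^-1 * U l t * (- (c (j%:Z - 1) * h)) ^+ l) -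
  h * \sum_(i < k) b i *
     (\sum_(l < m) l`!%:R^-1 * U l.+1 t * (- (c i%:Z * h)) ^+ l).
  by rewrite /u /v; ring.
under eq_bigr do rewrite mulrDr mulrDl.
rewrite big_split /=; congr (_ + _).
  under [RHS]eq_bigr do rewrite mulr_sumr.
  rewrite [RHS]exchange_big /=; apply: eq_bigr => l _.
  rewrite mulr_sumr mulr_suml; apply: eq_bigr => j _.
  by rewrite (exprNn (c _ * h)) exprMn; ring.
rewrite big_ord_recl /= mul0r mulr0 mul0r add0r -mulrN.
rewrite [X in _ = _ * - X](_ : _ = \sum_(l < m) \sum_(i < k) b i *
   (l`!%:R^-1 * U l.+1 t * (- (c i%:Z * h)) ^+ l)); last first.
  by rewrite exchange_big; apply: eq_bigr => i _; rewrite mulr_sumr.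
rewrite mulrN mulr_sumr -sumrN; apply: eq_bigr => l _.
rewrite /bump /= add1n subn1 /=.
rewrite !mulr_sumr mulr_suml -sumrN; apply: eq_bigr => i _.
rewrite (exprNn (c _ * h)) exprMn !exprS factS natrM invfM; field.
by rewrite nat1r !pnatr_eq0 -lt0n fact_gt0.
Unshelve. all: by end_near. Qed.


(** * Functions of class C^r *)

Lemma Cr_pred {R : realType} {V W : normedModType R} {m : nat} {g : V -> W} :
  Cr m.+1 g -> Cr m g.
Proof.
elim: m g => [|m IH] g [dg Dg]; first by move=> x; exact: differentiable_continuous.
by split=> // v; apply: IH; exact: Dg.
Qed.

Lemma Cr_le {R : realType} {V W : normedModType R} {m n : nat} {g : V -> W} :
  (m <= n)%N -> Cr n g -> Cr m g.
Proof.
move=> /subnK <-; elim: (n - m)%N => [//|d IH].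
by rewrite addSn => /Cr_pred.
Qed.

Lemma Cr_ext {R : realType} {V W : normedModType R} {m : nat} {f g : V -> W} :
  f =1 g -> Cr m g -> Cr m f.
Proof. by move=> /funext ->. Qed.

Lemma Cr_cst {R : realType} {V W : normedModType R} (m : nat) (w : W) :
  Cr m (fun _ : V => w).
Proof.
elim: m w => [|m IH] w; first by move=> x; exact: cvg_cst.
split=> [x|v]; first exact: differentiable_cst.
by apply: Cr_ext (IH 0) => x; exact: derive_cst.
Qed.

Lemma CrD {R : realType} {V W : normedModType R} {m : nat} {f g : V -> W} :
  Cr m f -> Cr m g -> Cr m (f + g).
Proof.
elim: m f g => [|m IH] f g; first by move=> cf cg x; exact: (cvgD (cf x) (cg x)).
move=> [df Df] [dg Dg]; split=> [x|v]; first exact: differentiableD.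
apply: Cr_ext (IH _ _ (Df v) (Dg v)) => x.
by rewrite deriveD//; exact: diff_derivable.
Qed.

Lemma CrM {R : realType} {V : normedModType R} {m : nat} {f g : V -> R} :
  Cr m f -> Cr m g -> Cr m (f * g).
Proof.
elim: m f g => [|m IH] f g; first by move=> cf cg x; exact: (cvgM (cf x) (cg x)).
move=> Cf Cg; have [df Df] := Cf; have [dg Dg] := Cg.
split=> [x|v]; first exact: differentiableM.
apply: Cr_ext (CrD (IH _ _ (Cr_pred Cf) (Dg v))
  (IH _ _ (Cr_pred Cg) (Df v))) => x.
by rewrite deriveM//; exact: diff_derivable.
Qed.

Lemma Cr_sum {R : realType} {V W : normedModType R} {m n : nat}
    {F : 'I_n -> V -> W} :
  (forall i, Cr m (F i)) -> Cr m (fun x => \sum_(i < n) F i x).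
Proof.
move=> CF.
apply: (@Cr_ext _ _ _ _ _ (\sum_(i < n) F i)).
  by move=> x; rewrite fct_sumE.
elim/big_ind : _ => // [|f g]; first exact: Cr_cst.
exact: CrD.
Qed.

Lemma derive_coord {R : realType} {V : normedModType R} {N : nat}
    (f : V -> 'cV[R]_N) (i : 'I_N) (x v : V) :
  differentiable f x -> 'D_v (fun y => f y i 0) x = ('D_v f x) i 0.
Proof.
by move=> df; rewrite derive_mx ?mxE//; exact: diff_derivable.
Qed.

Lemma differentiable_coord_comp {R : realType} {V : normedModType R} {N : nat}
    (f : V -> 'cV[R]_N) (i : 'I_N) (x : V) :
  differentiable f x -> differentiable (fun y => f y i 0) x.
Proof.
move=> df.
exact: (@differentiable_comp _ _ _ _ f (fun M : 'cV[R]_N => M i 0) x df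
  (differentiable_coord _ _ _)).
Qed.

Lemma Cr_coord {R : realType} {V : normedModType R} {N : nat} (m : nat)
    (f : V -> 'cV[R]_N) (i : 'I_N) :
  Cr m f -> Cr m (fun x => f x i 0).
Proof.
elim: m f => [|m IH] f.
  move=> cf x.
  have := differentiable_continuous (differentiable_coord (f x) i 0).
  by move=> /(continuous_comp (cf x)).
move=> [df Df]; split=> [x|v]; first exact: differentiable_coord_comp.
by apply: Cr_ext (IH _ (Df v)) => x; exact: derive_coord.
Qed.

Lemma Cr_id {R : realType} {V : normedModType R} (m : nat) : Cr m (fun x : V => x).
Proof.
case: m => [|m]; first by move=> x; exact: cvg_id.
split=> [x|v]; first exact/ex_diff.
by apply: Cr_ext (Cr_cst m v) => x; exact: derive_id.
Qed.

(** * Lie derivatives and regularity of solutions *)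

Definition lie {R : realType} {N : nat} (f : 'cV[R]_N -> 'cV[R]_N)
  (g : 'cV[R]_N -> R) (x : 'cV[R]_N) : R := 'D_(f x) g x.

(** The class C^r only controls 'D_v g for a fixed direction v, whereas the
    direction is here f x; expanding f x in the canonical basis writes the Lie
    derivative as a sum of products of functions of class C^m. *)
Lemma Cr_lie {R : realType} {N m : nat} {f : 'cV[R]_N -> 'cV[R]_N}
    {g : 'cV[R]_N -> R} :
  Cr m f -> Cr m.+1 g -> Cr m (lie f g).
Proof.
move=> Cf [dg Dg].
have Cfg j : Cr m ((fun x => f x j 0) * (fun x => 'D_(delta_mx j 0) g x)).
  by apply: CrM; [exact: Cr_coord|exact: Dg].
apply: Cr_ext (Cr_sum Cfg) => x.
rewrite /lie deriveE// {1}(matrix_sum_delta (f x)).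
rewrite linear_sum; apply: eq_bigr => j _.
by rewrite big_ord1 linearZ mulrfctE /= deriveE.
Qed.

Lemma Cr_iter_lie {R : realType} {N m l p : nat} {f : 'cV[R]_N -> 'cV[R]_N}
    {g : 'cV[R]_N -> R} :
  Cr p f -> (m + l <= p.+1)%N -> Cr (m + l) g -> Cr m (iter l (lie f) g).
Proof.
move=> Cf; elim: l m => [|l IH] m; first by rewrite addn0.
rewrite addnS => mp Cg; rewrite iterS; apply: Cr_lie.
  by apply: Cr_le Cf; move: mp; rewrite ltnS; apply: leq_trans; exact: leq_addr.
by apply: IH; rewrite addSn.
Qed.

Lemma lie_along {R : realType} {N : nat} {f : 'cV[R]_N -> 'cV[R]_N}
    {g : 'cV[R]_N -> R} {y : R -> 'cV[R]_N} {t : R} :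
  is_derive t (1 : R) y (f (y t)) -> differentiable g (y t) ->
  is_derive t (1 : R) (fun s => g (y s)) (lie f g (y t)).
Proof.
move=> [dy yE] dg.
have dy' : differentiable y t by apply/derivable1_diffP.
have dgy : differentiable (g \o y) t by exact: differentiable_comp.
apply: DeriveDef; first exact: diff_derivable.
rewrite deriveE// diff_comp//= /lie -yE.
by rewrite [in RHS]deriveE// [in RHS]deriveE.
Qed.

Lemma lie_coord {R : realType} {N : nat} (f : 'cV[R]_N -> 'cV[R]_N) (i : 'I_N) x :
  lie f (fun z => z i 0) x = f x i 0.
Proof. by rewrite /lie derive_coord// derive_id. Qed.

(** The continuity of the derivatives up to the end points comes for free, as
    they are continuous functions of y. *)
Lemma ode_solution_jet {R : realType} {N p : nat} {f : 'cV[R]_N -> 'cV[R]_N}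
    {t0 tF : R} {y : R -> 'cV[R]_N} (i : 'I_N) :
  Cr p f -> ode_solution f t0 tF y ->
  jet t0 tF p.+1 (fun l t => iter l (lie f) (fun z => z i 0) (y t)).
Proof.
move=> Cf [cy dy].
have Ccoord m : Cr m (fun z : 'cV[R]_N => z i 0) by apply: Cr_coord; exact: Cr_id.
split=> [l lp|l t lp tI].
  have cg := Cr_iter_lie (m := 0) Cf lp (Ccoord _).
  by move=> x; exact: (continuous_comp (cy x) (cg _)).
have [dg _] := Cr_iter_lie (m := 1) Cf lp (Ccoord _).
exact: (lie_along (dy t tI) (dg (y t))).
Qed.

(** * Order conditions of a multistep formula *)

Lemma lmm_defect_Oh {R : realType} {k : nat} {c a : int -> R}
    {b : nat -> R} {t0 tF t : R} {m : nat} {U : nat -> R -> R} :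
  jet t0 tF m.+1 U -> t \in `[t0, tF] ->
  (\forall h \near 0^'+, forall j : 'I_k.+1, t - c (j%:Z - 1) * h \in `[t0, tF]) ->
  (forall l, (l <= m)%N -> lmm_coef k c a b l = 0) ->
  Oh m.+1 (lmm_defect k c a b (U 0%N) (U 1%N) t).
Proof.
move=> jU tab near_ab coef0.
apply: Oh_near (lmm_defect_expansion c a b jU tab near_ab).
near=> h; rewrite big1 ?subr0// => l _.
by rewrite coef0 ?mulr0 ?mul0r// -ltnS.
Unshelve. all: by end_near. Qed.

Lemma near0_itv {R : realType} {n : nat} (q : 'I_n -> R) :
  \forall h \near 0^'+, forall j, 0 - q j * h \in `[-1, 1 : R].
Proof.
apply: filter_forall => j; near=> h.
have h0 : 0 < h by near: h; exact: nbhs_right_gt.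
have q1 : 0 < `|q j| + 1 by rewrite ltr_wpDl.
have : h < (`|q j| + 1)^-1 by near: h; apply: nbhs_right_lt; rewrite invr_gt0.
rewrite -(ltr_pM2l q1) mulfV ?gt_eqF// => hq.
rewrite sub0r in_itv /= -ler_norml normrN normrM (gtr0_norm h0).
by rewrite (le_trans _ (ltW hq))// ler_wpM2r ?(ltW h0)// lerDl.
Unshelve. all: by end_near. Qed.

Lemma expR_jet {R : realType} (a b : R) (m : nat) : jet a b m (fun=> expR).
Proof.
split=> [l _|l t _ _]; last exact: is_derive_expR.
by apply: continuous_subspaceT => x; exact: continuous_expR.
Qed.

(** The exponential is a sufficient test function because none of its
    derivatives vanishes at 0. *)
Lemma lmm_defect_expR {R : realType} {k : nat} {c a : int -> R}
    {b : nat -> R} {m : nat} :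
  Oh m.+1 (lmm_defect k c a b expR expR 0) ->
  forall l, (l <= m)%N -> lmm_coef k c a b l = 0.
Proof.
move=> Od l lm.
have I0 : 0 \in `[-1, 1 : R] by rewrite in_itv /= lerN10 ler01.
have near_ab := near0_itv (fun j : 'I_k.+1 => c (j%:Z - 1)).
have expansion := lmm_defect_expansion c a b (expR_jet _ _ m.+1) I0 near_ab.
pose q (i : nat) : R := i`!%:R^-1 * expR 0 * (-1) ^+ i * lmm_coef k c a b i.
have : Oh m.+1 (fun h => \sum_(i < m.+1) q i * h ^+ i).
  have := OhD Od (OhZ (-1) expansion).
  by apply: Oh_near; near=> h; rewrite /q; ring.
move=> /Oh_polynomial /(_ l lm) /eqP; rewrite /q expR0 mulr1.
rewrite !mulf_eq0 invr_eq0 signr_eq0 pnatr_eq0 (gtn_eqF (fact_gt0 l)) orbF /=.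
by move/eqP.
Unshelve. all: by end_near. Qed.

(** The two conditions on sums without powers of c are the cases l = 0, and the
    conditions on mu and nu are those of the formula (mu, - nu) shifted by one
    index. *)
Lemma order_conditionsP {R : realType} {k p : nat}
    {c alpha mu : int -> R} {beta nu : nat -> R} (hp : (1 <= p)%N) :
  ((forall l, (l <= p)%N -> lmm_coef k c alpha beta l = 0) /\
   (forall l, (l < p)%N -> lmm_coef k c mu (fun i => - nu i) l = 0)) <->
  [/\ \sum_(j < k.+1) alpha (j%:Z - 1) = 0,
      \sum_(j < k.+1) mu (j%:Z - 1) = 0,
      (forall l : nat, (1 <= l <= p)%N ->
         \sum_(j < k.+1) alpha (j%:Z - 1) * c (j%:Z - 1) ^+ l +
         l%:R * (\sum_(i < k) beta i * c i%:Z ^+ (l - 1)) = 0) &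
      (forall l : nat, (2 <= l <= p)%N ->
         \sum_(j < k.+1) mu (j%:Z - 1) * c (j%:Z - 1) ^+ (l - 1) -
         (l - 1)%:R * (\sum_(i < k) nu i * c i%:Z ^+ (l - 2)) = 0)].
Proof.
have coef0 (a : int -> R) b :
    lmm_coef k c a b 0 = \sum_(j < k.+1) a (j%:Z - 1).
  rewrite /lmm_coef mul0r addr0; apply: eq_bigr => j _.
  by rewrite expr0 mulr1.
have coef_mu l : lmm_coef k c mu (fun i => - nu i) l.+1 =
    \sum_(j < k.+1) mu (j%:Z - 1) * c (j%:Z - 1) ^+ (l.+2 - 1) -
    (l.+2 - 1)%:R * (\sum_(i < k) nu i * c i%:Z ^+ (l.+2 - 2)).
  rewrite /lmm_coef !subSS !subn0 -mulrN -sumrN; congr (_ + _ * _).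
  by apply: eq_bigr => i _; rewrite mulNr.
split=> [[ca cm]|[a0 m0 ca cm]].
  split; first by rewrite -(coef0 _ beta) ca.
  - by rewrite -(coef0 _ (fun i => - nu i)) cm.
  - by move=> l /andP[_ lp]; exact: ca.
  - by case=> [|[|l]] // /andP[_ lp]; rewrite -coef_mu cm.
split=> [[|l] lp|[|l] lp].
- by rewrite coef0.
- by apply: ca; rewrite lp.
- by rewrite coef0.
- by rewrite coef_mu cm.
Qed.

(** * The error equation of one step *)

Definition limm_residual {R : realType} {N : nat} (k : nat)
    (alpha mu : int -> R) (beta nu : nat -> R)
    (f : 'cV[R]_N -> 'cV[R]_N) (A : 'M[R]_N) (h : R)
    (Y : int -> 'cV[R]_N) : 'cV[R]_N :=
  \sum_(j < k.+1) alpha (j%:Z - 1) *: Y (j%:Z - 1) -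
  (h *: (\sum_(i < k) beta i *: f (Y i%:Z)) +
   h *: (A *m (\sum_(j < k.+1) mu (j%:Z - 1) *: Y (j%:Z - 1) +
                h *: (\sum_(i < k) nu i *: f (Y i%:Z))))).

Lemma limm_stepP {R : realType} {N k : nat} {alpha mu : int -> R}
    {beta nu : nat -> R} {f : 'cV[R]_N -> 'cV[R]_N} {A : 'M[R]_N} {h : R}
    {Y : int -> 'cV[R]_N} :
  limm_step k alpha mu beta nu f A h Y <->
  limm_residual k alpha mu beta nu f A h Y = 0.
Proof.
split=> [step|/eqP]; last by rewrite subr_eq0 => /eqP.
by apply/eqP; rewrite subr_eq0; apply/eqP.
Qed.

(** The value at -1 enters linearly and never through f; this gives the error
    equation when w is the computed value and Y are the exact ones. *)
Lemma limm_residual_replace {R : realType} {N k : nat}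
    {alpha mu : int -> R} {beta nu : nat -> R}
    {f : 'cV[R]_N -> 'cV[R]_N} {A : 'M[R]_N} {h : R}
    (Y : int -> 'cV[R]_N) (w : 'cV[R]_N) :
  alpha (-1) = 1 ->
  limm_residual k alpha mu beta nu f A h (fun i => if i == -1 then w else Y i) =
  limm_residual k alpha mu beta nu f A h Y +
  ((w - Y (-1)) - (h * mu (-1)) *: (A *m (w - Y (-1)))).
Proof.
move=> alpha1; rewrite /limm_residual.
have recl (a : int -> R) (Z : int -> 'cV[R]_N) :
    \sum_(j < k.+1) a (j%:Z - 1) *: Z (j%:Z - 1) =
    a (-1) *: Z (-1) + \sum_(i < k) a i%:Z *: Z i%:Z.
  rewrite big_ord_recl /= sub0r; congr (_ + _).
  by apply: eq_bigr => i _; rewrite /bump add1n succ_sub1.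
pose Y' i := if i == -1 then w else Y i.
rewrite (recl alpha Y') (recl mu Y') (recl alpha Y) (recl mu Y) /Y' /=.
rewrite alpha1 !scale1r.
set S1 := \sum_(i < k) alpha _ *: _; set S2 := \sum_(i < k) beta _ *: _.
set S3 := \sum_(i < k) mu _ *: _; set S4 := \sum_(i < k) nu _ *: _.
rewrite !mulmxDr -!scalemxAr mulmxN.
move: (A *m w) (A *m Y (-1)) (A *m S3) (A *m S4) => Aw AY A3 A4.
by apply/matrixP => i j; rewrite !mxE; ring.
Qed.

Lemma limm_residual_coord {R : realType} {N k : nat}
    {c alpha mu : int -> R} {beta nu : nat -> R}
    {f : 'cV[R]_N -> 'cV[R]_N} {A : 'M[R]_N} {t h : R}
    {y : R -> 'cV[R]_N} {i : 'I_N} :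
  limm_residual k alpha mu beta nu f A h (fun j => y (t - c j * h)) i 0 =
  lmm_defect k c alpha beta (fun s => y s i 0) (fun s => f (y s) i 0) t h -
  h * \sum_(j < N) A i j *
    lmm_defect k c mu (fun l => - nu l)
      (fun s => y s j 0) (fun s => f (y s) j 0) t h.
Proof.
have coord_sum n (F : 'I_n -> 'cV[R]_N) (q : 'I_n -> R) (j : 'I_N) :
    (\sum_l q l *: F l) j 0 = \sum_l q l * F l j 0.
  by rewrite summxE; apply: eq_bigr => l _; rewrite mxE.
rewrite /limm_residual /lmm_defect !mxE !coord_sum opprD addrA.
congr (_ - _ - _ * _).
apply: eq_bigr => j _; congr (_ * _); rewrite !mxE !coord_sum; congr (_ + _).
rewrite -mulrN -sumrN; congr (_ * _).
by apply: eq_bigr => l _; rewrite mulNr opprK.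
Qed.

Lemma mx_norm_coord_le {R : realType} {N : nat} (v : 'cV[R]_N) (i : 'I_N) :
  `|v i 0| <= `|v|.
Proof.
rewrite [leRHS]/Num.Def.normr/= mx_normrE.
exact: (le_bigmax _ (fun ij : 'I_N * 'I_1 => `|v ij.1 ij.2|) (i, 0)).
Qed.

Lemma mx_norm_le {R : realType} {N : nat} (v : 'cV[R]_N) (B : R) :
  0 <= B -> (forall i, `|v i 0| <= B) -> `|v| <= B.
Proof.
move=> B0 vB; rewrite [leLHS]/Num.Def.normr/= mx_normrE.
by apply: (bigmax_le _ B0) => -[i j] _ /=; rewrite (ord1 j).
Qed.

Lemma mulmx_norm_le {R : realType} {N : nat} (A : 'M[R]_N) (v : 'cV[R]_N) :
  `|A *m v| <= (\sum_i \sum_j `|A i j|) * `|v|.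
Proof.
apply: mx_norm_le => [|i].
  by rewrite mulr_ge0// sumr_ge0// => i _; rewrite sumr_ge0.
rewrite mxE (le_trans (ler_norm_sum _ _ _))//.
apply: (@le_trans _ _ ((\sum_j `|A i j|) * `|v|)).
  rewrite mulr_suml; apply: ler_sum => j _.
  by rewrite normrM ler_wpM2l// mx_norm_coord_le.
rewrite ler_wpM2r// [leRHS](bigD1 i)//= lerDl sumr_ge0// => l _.
by rewrite sumr_ge0.
Qed.

Lemma Oh_uniform {R : realType} {m n : nat} {F : 'I_n -> R -> R} :
  (forall i, Oh m (F i)) ->
  exists2 K : R, 0 <= K & \forall h \near 0^'+, forall i, `|F i h| <= K * h ^+ m.
Proof.
move=> OF; exists (\sum_i `|sval (cid (OF i))|); first by rewrite sumr_ge0.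
apply: filter_forall => i; near=> h.
have h0 : 0 < h by near: h; exact: nbhs_right_gt.
apply: (@le_trans _ _ (sval (cid (OF i)) * h ^+ m)).
  by near: h; exact: (svalP (cid (OF i))).
rewrite ler_wpM2r ?exprn_ge0 ?(ltW h0)// (le_trans (ler_norm _))//.
by rewrite (bigD1 i)//= lerDl sumr_ge0.
Unshelve. all: by end_near. Qed.

(** * Sufficiency *)

Lemma order_conditions_consistent {R : realType} {N k p r : nat}
    {c alpha mu : int -> R} {beta nu : nat -> R} :
  (1 <= k)%N -> (1 <= p)%N -> (p <= r)%N ->
  c (-1) = -1 -> c 0 = 0 -> alpha (-1) = 1 ->
  (forall l, (l <= p)%N -> lmm_coef k c alpha beta l = 0) ->
  (forall l, (l < p)%N -> lmm_coef k c mu (fun i => - nu i) l = 0) ->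
  limmw_consistent N k c alpha mu beta nu r p.
Proof.
move=> hk hp hr c1 c0 alpha1 coefa coefm f A t0 tF tn y z.
move=> /(Cr_le hr) Cf sol near_ab step.
(* The grid point with index 0 is tn itself. *)
have tnab : tn \in `[t0, tF].
  have [h hab] := filter_ex near_ab.
  have := hab (lift ord0 (Ordinal hk)).
  by rewrite lift0 succ_sub1 /= c0 mul0r subr0.
pose D h := limm_residual k alpha mu beta nu f A h (fun j => y (tn - c j * h)).
have lieE i : (fun s => lie f (fun v => v i 0) (y s)) = (fun s => f (y s) i 0).
  by apply/funext => s; rewrite lie_coord.
have Oalpha i : Oh p.+1 (lmm_defect k c alpha beta
    (fun s => y s i 0) (fun s => f (y s) i 0) tn).
  have := lmm_defect_Oh (ode_solution_jet i Cf sol) tnab near_ab coefa.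
  by rewrite /= lieE.
have Omu i : Oh p (lmm_defect k c mu (fun i => - nu i)
    (fun s => y s i 0) (fun s => f (y s) i 0) tn).
  case: p hp hr Cf coefa coefm Oalpha => [//|p] hp hr Cf coefa coefm _.
  have [cU dU] := ode_solution_jet i Cf sol.
  have jU : jet t0 tF p.+1 (fun l t => iter l (lie f) (fun z => z i 0) (y t)).
    split=> [l lp|l t lp]; first exact: (cU l (leqW lp)).
    exact: (dU l t (leqW lp)).
  by have := lmm_defect_Oh jU tnab near_ab coefm; rewrite /= lieE.
have OD i : Oh p.+1 (fun h => D h i 0).
  have := OhD (Oalpha i) (OhZ (-1)
    (proj2 Oh_mulX (Oh_sum (fun j => OhZ (A i j) (Omu j))))).
  by apply: Oh_near; near=> h; rewrite /D limm_residual_coord mulN1r.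
have [K K0 DK] := Oh_uniform OD.
pose a := \sum_i \sum_j `|A i j|.
have a0 : 0 <= a by rewrite sumr_ge0// => i _; rewrite sumr_ge0.
(* If |mu (-1)| * h * a <= 1/2, the error equation bounds |E| by |E|/2 + |D|. *)
have q1 : 0 < 2 * (`|mu (-1)| * a + 1) by rewrite mulr_gt0// ltr_wpDl ?mulr_ge0.
apply/eqO_exP; exists (2 * K + 1); first by rewrite ltr_wpDl ?mulr_ge0.
near=> h.
have h0 : 0 < h by near: h; exact: nbhs_right_gt.
have stepE : limm_residual k alpha mu beta nu f A h
    (fun i => if i == -1 then z h else y (tn - c i * h)) = 0.
  by apply/limm_stepP; near: h.
move: stepE; rewrite limm_residual_replace// c1 mulN1r opprK.
set E := z h - _; rewrite -/(D h) => stepE.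
have DE : `|D h| <= K * h ^+ p.+1.
  by apply: mx_norm_le; [rewrite mulr_ge0 ?exprn_ge0 ?(ltW h0)|near: h].
have EE : E = (h * mu (-1)) *: (A *m E) - D h.
  by apply/eqP; rewrite -subr_eq0 opprB addrCA stepE.
have AE := mulmx_norm_le A E; rewrite -/a in AE.
have half : h * (`|mu (-1)| * a) <= 2^-1.
  have : h < (2 * (`|mu (-1)| * a + 1))^-1.
    by near: h; apply: nbhs_right_lt; rewrite invr_gt0.
  rewrite -(ltr_pM2l q1) mulfV ?gt_eqF// => hq.
  by have := mulr_ge0 (normr_ge0 (mu (-1))) a0; nra.
have : `|E| <= 2^-1 * `|E| + K * h ^+ p.+1.
  rewrite {1}EE (le_trans (ler_normB _ _))// lerD//.
  rewrite normrZ normrM (gtr0_norm h0).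
  rewrite (le_trans (ler_wpM2l _ AE)) ?mulr_ge0 ?(ltW h0)//.
  by rewrite mulrA -[h * _ * a]mulrA ler_wpM2r.
rewrite ger0_norm ?exprn_ge0 ?(ltW h0)//.
have := exprn_ge0 p.+1 (ltW h0).
by move: (h ^+ p.+1) => hp1; nra.
Unshelve. all: by end_near. Qed.


(** * Necessity *)

(** All coordinates are equal to exp t, so that scalar matrices A act on the
    curve as scalars. *)
Definition exp_curve {R : realType} (N : nat) (t : R) : 'cV[R]_N :=
  const_mx (expR t).

Lemma exp_curve_solution {R : realType} (N : nat) (a b : R) :
  ode_solution (fun x => x) a b (@exp_curve R N).
Proof.
have dexp t : derivable (@exp_curve R N) t 1.
  apply/derivable_mxP => i j.
  rewrite (_ : (fun _ => _) = expR); first exact: derivable_expR.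
  by apply/funext => s; rewrite mxE.
split=> [|t _].
  apply: continuous_subspaceT => t.
  by apply/differentiable_continuous/derivable1_diffP.
apply: DeriveDef => //; rewrite derive_mx//; apply/matrixP => i j; rewrite !mxE.
rewrite (_ : (fun _ => _) = expR); first by rewrite derive_val.
by apply/funext => s; rewrite mxE.
Qed.

(** For f = id and A = a I the scheme can be solved explicitly for y_(n+1), as
    long as 1 - h mu_(-1) a is nonzero; the residual is then a bounded multiple
    of the error. *)
Lemma consistent_expR {R : realType} {N k p r : nat}
    {c alpha mu : int -> R} {beta nu : nat -> R} (a : R) :
  (1 <= N)%N -> c (-1) = -1 -> alpha (-1) = 1 ->
  limmw_consistent N k c alpha mu beta nu r p ->
  Oh p.+1 (fun h => lmm_defect k c alpha beta expR expR 0 h -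
    h * (a * lmm_defect k c mu (fun i => - nu i) expR expR 0 h)).
Proof.
move=> hN c1 alpha1 cons.
pose D h := limm_residual k alpha mu beta nu (fun x : 'cV[R]_N => x) a%:M h
  (fun j => exp_curve N (0 - c j * h)).
(* The error forced by the error equation. *)
pose E h := - (1 - h * mu (-1) * a)^-1 *: D h.
have unit_near : \forall h \near (0 : R)^'+, 1 - h * mu (-1) * a != 0.
  have b0 : 0 < `|mu (-1) * a| + 1 by rewrite ltr_wpDl.
  near=> h.
  have h0 : 0 < h by near: h; exact: nbhs_right_gt.
  have : h < (`|mu (-1) * a| + 1)^-1 by near: h; apply: nbhs_right_lt; rewrite invr_gt0.
  rewrite -(ltr_pM2l b0) mulfV ?(gt_eqF b0)// => hb.
  rewrite gt_eqF//; have := ler_norm (mu (-1) * a); nra.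
pose i0 := Ordinal hN.
have DE h i : D h i 0 = lmm_defect k c alpha beta expR expR 0 h -
    h * (a * lmm_defect k c mu (fun i => - nu i) expR expR 0 h).
  have coordE (j : 'I_N) : (fun s => exp_curve N s j 0) = @expR R.
    by apply/funext => s; rewrite mxE.
  rewrite /D limm_residual_coord coordE; congr (_ - h * _).
  rewrite (bigD1 i)//= coordE big1 ?addr0 => [|j ji]; first by rewrite mxE eqxx.
  by rewrite mxE eq_sym (negbTE ji) mul0r.
have step : \forall h \near 0^'+,
    limm_step k alpha mu beta nu (fun x : 'cV[R]_N => x) a%:M h
      (fun i => if i == -1 then exp_curve N (0 + h) + E h
                else exp_curve N (0 - c i * h)).
  near=> h; apply/limm_stepP.
  rewrite (limm_residual_replace (fun i => exp_curve N (0 - c i * h)))//.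
  rewrite -/(D h).
  rewrite c1 mulN1r opprK [_ + E h]addrC addrK /E.
  have u0 : 1 - h * mu (-1) * a != 0 by near: h.
  move: (D h) => d; rewrite mul_scalar_mx.
  by apply/matrixP => i j; rewrite !mxE; field.
have := cons (fun x => x) a%:M (-1) 1 0 (exp_curve N)
  (fun h => exp_curve N (0 + h) + E h) (Cr_id r) (exp_curve_solution _ _ _)
  (near0_itv _) step.
move=> /eqO_exP[K K0 HK].
have OE : Oh p.+1 (fun h => E h i0 0).
  exists K; near=> h.
  have h0 : 0 < h by near: h; exact: nbhs_right_gt.
  apply: le_trans (mx_norm_coord_le (E h) i0) _.
  have : `|exp_curve N (0 + h) + E h - exp_curve N (0 + h)| <= K * `|h ^+ p.+1|.
    by near: h.
  by rewrite (ger0_norm (exprn_ge0 p.+1 (ltW h0))) [_ + E h]addrC addrK.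
(* The residual is - (1 - h mu_(-1) a) times the error. *)
have := OhD (OhZ (-1) OE) (OhZ (mu (-1) * a) (Oh_le (leqnSn _) (proj2 Oh_mulX OE))).
apply: Oh_near; near=> h.
have u0 : 1 - h * mu (-1) * a != 0 by near: h.
rewrite -(DE h i0) /E mxE; move: (D h i0 0) => d; field.
Unshelve. all: by end_near. Qed.

(** * Characterization of the order *)

Theorem theorem3p2 (R : realType) (N k p r : nat)
    (c alpha mu : int -> R) (beta nu : nat -> R)
    (hN : (1 <= N)%N) (hk : (1 <= k)%N) (hp : (1 <= p)%N) (hr : (p <= r)%N)
    (hcN1 : c (-1) = -1) (hc0 : c 0 = 0) (halpha : alpha (-1) = 1) :
  limmw_consistent N k c alpha mu beta nu r p <->
  [/\ \sum_(j < k.+1) alpha (j%:Z - 1) = 0,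
      \sum_(j < k.+1) mu (j%:Z - 1) = 0,
      (forall l : nat, (1 <= l <= p)%N ->
         \sum_(j < k.+1) alpha (j%:Z - 1) * c (j%:Z - 1) ^+ l +
         l%:R * (\sum_(i < k) beta i * c i%:Z ^+ (l - 1)) = 0) &
      (forall l : nat, (2 <= l <= p)%N ->
         \sum_(j < k.+1) mu (j%:Z - 1) * c (j%:Z - 1) ^+ (l - 1) -
         (l - 1)%:R * (\sum_(i < k) nu i * c i%:Z ^+ (l - 2)) = 0)].
Proof.
rewrite -order_conditionsP//; split=> [cons|[coefa coefm]]; last first.
  exact: order_conditions_consistent.
have O0 : Oh p.+1 (lmm_defect k c alpha beta expR expR 0).
  apply: Oh_near (consistent_expR 0 hN hcN1 halpha cons).
  by near=> h; rewrite mul0r mulr0 subr0.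
split; first exact: lmm_defect_expR.
have : Oh p (lmm_defect k c mu (fun i => - nu i) expR expR 0).
  apply/Oh_mulX.
  have := OhD O0 (OhZ (-1)
    (consistent_expR 1 hN hcN1 halpha cons)).
  by apply: Oh_near; near=> h; ring.
case: p hp hr {cons O0} => [//|p] _ _ Om l lp.
exact: lmm_defect_expR Om l lp.
Unshelve. all: by end_near. Qed.
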